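(* There exists a universal constant $\epsilon_0>0$ such that for every finite graph $\mathcal{G}$, with $\mathcal{G}'$ its Peeters supergraph and $(A,\mathcal{X})$ the $(P_3)$ input construction for $\mathcal{G}$, the following hold. 1. If $\mathcal{G}$ is 3-colorable, there exists $L\in\mathbb{S}^{3|\mathcal{V}(\mathcal{G}')|}$ fitting $\mathcal{X}$ such that $\operatorname{rank}(A+L)\le 3$ and $A+L\succeq 0$. 2. Conversely, if there exist $L\in\mathbb{S}^{3|\mathcal{V}(\mathcal{G}')|}$ and $H\in\mathbb{S}^{3|\mathcal{V}(\mathcal{G}')|}$ such that (a) $L$ fits $\mathcal{X}$, (b) $\|H\|_F\le\epsilon_0$, (c) $A+L+H\succeq 0$, and (d) $\operatorname{rank}(A+L+H)\le 3$, then $\mathcal{G}$ is 3-colorable.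
   Context: All graphs are finite, undirected, simple and loopless; $\mathcal{V}(\cdot)$, $\mathcal{E}(\cdot)$ denote vertex and edge sets. $\mathbb{S}^N$ is the space of real symmetric $N\times N$ matrices, $\succeq0$ means positive semidefinite, $\|\cdot\|_F$ is the Frobenius norm. A matrix $L\in\mathbb{S}^N$ fits a set $\mathcal{X}$ of unordered pairs of distinct indices if $L_{uv}=0$ for all $\{u,v\}\in\mathcal{X}$ (the diagonal entries of $L$, and entries not indexed by $\mathcal{X}$, are unrestricted). Peeters supergraph: $\mathcal{G}'$ is obtained from $\mathcal{G}$ by adding, for each unordered pair of distinct vertices $i,j\in\mathcal{V}(\mathcal{G})$ (adjacent or not, listed in some fixed order $i,j$), four new vertices $a_{ij},b_{ij},c_{ij},d_{ij}$ and the nine edges $\{i,a_{ij}\},\{i,b_{ij}\},\{a_{ij},b_{ij}\},\{j,c_{ij}\},\{j,d_{ij}\},\{c_{ij},d_{ij}\},\{a_{ij},j\},\{i,d_{ij}\},\{b_{ij},c_{ij}\}$. $(P_3)$ input construction: every vertex $i$ of $\mathcal{G}'$ corresponds to three indices $i^{(1)},i^{(2)},i^{(3)}$. The matrix $A\in\mathbb{S}^{3|\mathcal{V}(\mathcal{G}')|}$ is $A:=I\otimes E-I$, where $E$ is the $3\times 3$ all-ones matrix; i.e. $A(i^{(\mu)},i^{(\nu)})=1$ for $\mu\ne\nu$ and all other entries (including the diagonal) are $0$. The set $\mathcal{X}$ consists of the nine pairs $\{i^{(\mu)},j^{(\nu)}\}$, $\mu,\nu\in\{1,2,3\}$, for each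 edge $\{i,j\}\in\mathcal{E}(\mathcal{G}')$, together with the three pairs $\{i^{(\mu)},i^{(\nu)}\}$, $\mu\neq\nu$, for each $i\in\mathcal{V}(\mathcal{G}')$. *)

(* Defs.v *)
From HB Require Import structures.
From mathcomp Require Import all_boot all_order all_algebra.
From mathcomp Require Import reals mxtens.
Set Implicit Arguments.
Unset Strict Implicit.
Unset Printing Implicit Defensive.
Import Order.TTheory GRing.Theory Num.Theory.
Local Open Scope ring_scope.

Record graph := Graph {
  vertex :> finType;
  adj : rel vertex;
  adj_sym : symmetric adj;
  adj_irr : irreflexive adj }.

Definition colorable (k : nat) (G : graph) : Prop :=
  exists f : G -> 'I_k, forall x y : G, adj x y -> f x != f y.

(* [o i j] says that the unordered pair {i, j} of distinct elements is listed
   as (i, j); exactly one of the two orders is chosen, arbitrarily. *)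
Definition pair_listing (T : finType) (o : rel T) : Prop :=
  irreflexive o /\ (forall i j : T, i != j -> o i j = ~~ o j i).

Inductive gadget := Ga | Gb | Gc | Gd.

Definition ord_of_gadget (g : gadget) : 'I_4 :=
  inord match g with Ga => 0 | Gb => 1 | Gc => 2 | Gd => 3 end.

Definition gadget_of_ord (k : 'I_4) : gadget :=
  match val k with 0 => Ga | 1 => Gb | 2 => Gc | _ => Gd end.

Lemma ord_of_gadgetK : cancel ord_of_gadget gadget_of_ord.
Proof. by case; rewrite /gadget_of_ord /ord_of_gadget /= inordK. Qed.

HB.instance Definition _ := Finite.copy gadget (can_type ord_of_gadgetK).

Section Peeters.
Variables (G : graph) (o : rel G).

Definition listed_pair : finType := {p : G * G | o p.1 p.2}.

Definition peeters_vertex : finType := (G + listed_pair * gadget)%type.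

Definition gadget_edges (p : listed_pair) :
    seq (peeters_vertex * peeters_vertex) :=
  let i : peeters_vertex := inl (val p).1 in
  let j : peeters_vertex := inl (val p).2 in
  let a : peeters_vertex := inr (p, Ga) in
  let b : peeters_vertex := inr (p, Gb) in
  let c : peeters_vertex := inr (p, Gc) in
  let d : peeters_vertex := inr (p, Gd) in
  [:: (i, a); (i, b); (a, b); (j, c); (j, d); (c, d); (a, j); (i, d); (b, c)].

Definition peeters_adj (x y : peeters_vertex) : bool :=
  match x, y with inl i, inl j => adj i j | _, _ => false end
  || [exists p, ((x, y) \in gadget_edges p) || ((y, x) \in gadget_edges p)].

Lemma peeters_adj_sym : symmetric peeters_adj.
Proof.
move=> x y; rewrite /peeters_adj; congr (_ || _).
  by case: x y => [i|u] [j|v] //; rewrite adj_sym.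
by apply: eq_existsb => p; rewrite orbC.
Qed.

Lemma peeters_adj_irr : irreflexive peeters_adj.
Proof.
move=> x; rewrite /peeters_adj.
have -> /= : match x, x with inl i, inl j => adj i j | _, _ => false end = false.
  by case: x => // i; rewrite adj_irr.
apply/existsP => -[p]; rewrite orbb !inE !xpair_eqE.
by case: x => [i|[q []]] /=; rewrite -?topredE /= ?andbF ?orbF //=;
  do ?[case/orP]; case/andP=> /eqP-> /eqP.
Qed.

Definition peeters : graph := Graph peeters_adj_sym peeters_adj_irr.

End Peeters.

Section MatrixNotions.
Variables (R : realType) (N : nat).
Implicit Types (M L : 'M[R]_N).

Definition psd M : Prop := forall x : 'cV[R]_N, 0 <= (x^T *m M *m x) 0 0.

Definition frobenius_norm M : R := Num.sqrt (\sum_i \sum_j M i j ^+ 2).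

Definition fits L (X : {set {set 'I_N}}) : Prop :=
  forall u v : 'I_N, [set u; v] \in X -> L u v = 0.

End MatrixNotions.

Section P3Input.
Variable G : graph.

(* The index i^(mu), ordered compatibly with the Kronecker product [*t]. *)
Definition copy_index (i : G) (mu : 'I_3) : 'I_(#|G| * 3) :=
  mxtens_index (enum_rank i, mu).

Definition P3_matrix (R : realType) : 'M[R]_(#|G| * 3) :=
  (1%:M : 'M[R]_#|G|) *t (const_mx 1 : 'M[R]_3) - 1%:M.

Lemma P3_matrixE (R : realType) (i j : G) (mu nu : 'I_3) :
  P3_matrix R (copy_index i mu) (copy_index j nu)
  = ((i == j) && (mu != nu))%:R.
Proof.
rewrite !mxE !mxtens_indexK /= (can_eq (@mxtens_indexK _ _)) xpair_eqE.
rewrite (inj_eq enum_rank_inj) mulr1.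
by case: (i == j) => /=; case: (mu == nu); rewrite /= ?subrr ?subr0.
Qed.

Definition P3_pairs : {set {set 'I_(#|G| * 3)}} :=
  (\bigcup_(e : G * G | adj e.1 e.2)
     [set [set copy_index e.1 mu; copy_index e.2 nu] | mu : 'I_3, nu : 'I_3])
  :|:
  (\bigcup_(i : G)
     [set [set copy_index i m.1; copy_index i m.2]
       | m : 'I_3 * 'I_3 & m.1 != m.2]).

End P3Input.

(* Main.v *)
Require Import Defs.
From mathcomp Require Import all_boot all_order all_algebra.
From mathcomp Require Import reals mxtens ring lra.
Set Implicit Arguments.
Unset Strict Implicit.
Unset Printing Implicit Defensive.
Import Order.TTheory GRing.Theory Num.Theory.
Local Open Scope ring_scope.

(** A colouring gives the completion at once: a 3-colouring [f] of the base
graph extends over every gadget ([peeters_colorable]), and the Gram matrix of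
the vectors e_(f x), each repeated three times, has rank at most 3 and agrees
with the input matrix at every specified position ([P3_completion]).

Conversely, a positive semidefinite matrix of rank at most 3 is the Gram matrix
of vectors in a 3-dimensional Euclidean space. Its diagonal is unconstrained,
so the vectors have no bounded length, but among the three copies of a vertex
the inner products are close to 1, hence one copy has squared length at least
1/2. Normalising that copy yields one unit vector per vertex of the supergraph,
and adjacent vertices have nearly orthogonal unit vectors
([P3_correlations]).

In a gadget on i, j the triples (i, a, b) and (j, c, d) are then nearly
orthonormal, and a, d, b are nearly orthogonal to j, i, c respectively. In
coordinates along i, a, b one has j = (x, 0, y), d = (0, p, q) and
c = (r, s, 0) up to small errors, and orthogonality of j, c, d gives
qy = rx = sp = 0. As x^2 + y^2 = p^2 + q^2 = r^2 + s^2 = 1, this forces xy = 0: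
the vectors of i and j are nearly parallel or nearly orthogonal
([gadget_dichotomy]). This dichotomy holds for every pair of vertices of the
base graph. A maximal set S of pairwise non-parallel vertices is therefore
nearly orthonormal, so it has at most three elements
([no_four_near_orthogonal]); sending each vertex to an element of S nearly
parallel to it is a proper colouring, since two vectors nearly parallel to a
third one are not nearly orthogonal ([near_parallel_common]).

The argument only sees inner products. Coordinates in an almost orthonormal
frame are read off from the vanishing of a 4 x 4 minor ([frame_expansion]), so
the vectors themselves never have to be extracted from the matrix. *)

(** * Polynomial estimates *)

Lemma ler_norml_mul1 (R : realFieldType) (e s t : R) :
  `|s| <= e -> `|t| <= 1 -> `|s * t| <= e.
Proof.
by move=> hs ht; rewrite normrM; apply: le_trans hs; rewrite ler_piMr.
Qed.

Lemma ler_norml_bounds (R : realFieldType) (x r : R) :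
  `|x| <= r -> - r <= x /\ x <= r.
Proof. by rewrite ler_norml => /andP. Qed.

(** The hypothesis on [w] says that the 4 x 4 determinant with upper left block
the symmetric matrix with unit diagonal and off-diagonal entries [a], [b], [c],
bordered by the row [u], the column [v] and the corner [w], vanishes. Every
monomial of the difference to be bounded contains a factor [a], [b] or [c], and
there are twenty of them with multiplicity: [A], [B] and [C] collect their
cofactors. *)
Lemma bordered_bound (R : realFieldType) (a b c w u1 u2 u3 v1 v2 v3 e : R) :
  `|a| <= e -> `|b| <= e -> `|c| <= e -> e <= 1 ->
  `|w| <= 1 -> `|u1| <= 1 -> `|u2| <= 1 -> `|u3| <= 1 ->
  `|v1| <= 1 -> `|v2| <= 1 -> `|v3| <= 1 ->
  w * (1 - a ^+ 2 - b ^+ 2 - c ^+ 2 + 2 * a * b * c) =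
    u1 * v1 * (1 - c ^+ 2) + u2 * v2 * (1 - b ^+ 2)
  + u3 * v3 * (1 - a ^+ 2)
  + (u1 * v2 + u2 * v1) * (b * c - a)
  + (u1 * v3 + u3 * v1) * (a * c - b)
  + (u2 * v3 + u3 * v2) * (a * b - c) ->
  `|w - (u1 * v1 + u2 * v2 + u3 * v3)| <= 20 * e.
Proof.
move=> ha hb hc e1 hw hu1 hu2 hu3 hv1 hv2 hv3 E.
have le1 t : `|t| <= e -> `|t| <= 1 by move=> /le_trans; apply.
have [la lb lc] : [/\ `|a| <= 1, `|b| <= 1 & `|c| <= 1] by rewrite !le1.
have M1 (s t : R) : `|s| <= 1 -> `|t| <= 1 -> `|s * t| <= 1.
  exact: ler_norml_mul1.
pose A := w * a - 2 * (w * b * c) - u3 * v3 * a - (u1 * v2 + u2 * v1)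
  + (u1 * v3 + u3 * v1) * c + (u2 * v3 + u3 * v2) * b.
pose B := w * b - u2 * v2 * b - (u1 * v3 + u3 * v1) + (u1 * v2 + u2 * v1) * c.
pose C := w * c - u1 * v1 * c - (u2 * v3 + u3 * v2).
have -> : w - (u1 * v1 + u2 * v2 + u3 * v3) = a * A + b * B + c * C.
  by rewrite /A /B /C; lra.
have M3 (r s t : R) : `|r| <= 1 -> `|s| <= 1 -> `|t| <= 1 ->
    - 1 <= r * s * t /\ r * s * t <= 1.
  by move=> hr hs ht; apply: ler_norml_bounds; apply: (M1) => //; apply: M1.
have M2 (r s : R) : `|r| <= 1 -> `|s| <= 1 -> - 1 <= r * s /\ r * s <= 1.
  by move=> hr hs; apply: ler_norml_bounds; apply: M1.
have [[? ?] [? ?]] := (M2 _ _ hu1 hv2, M2 _ _ hu2 hv1).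
have [[? ?] [? ?]] := (M2 _ _ hu1 hv3, M2 _ _ hu3 hv1).
have [[? ?] [? ?]] := (M2 _ _ hu2 hv3, M2 _ _ hu3 hv2).
have hA : `|A| <= 10.
  have [[? ?] [? ?]] := (M2 _ _ hw la, M3 _ _ _ hw lb lc).
  have [? ?] := M3 _ _ _ hu3 hv3 la.
  have [[? ?] [? ?]] := (M3 _ _ _ hu1 hv3 lc, M3 _ _ _ hu3 hv1 lc).
  have [[? ?] [? ?]] := (M3 _ _ _ hu2 hv3 lb, M3 _ _ _ hu3 hv2 lb).
  by rewrite /A ler_norml; apply/andP; split; lra.
have hB : `|B| <= 6.
  have [[? ?] [? ?]] := (M2 _ _ hw lb, M3 _ _ _ hu2 hv2 lb).
  have [[? ?] [? ?]] := (M3 _ _ _ hu1 hv2 lc, M3 _ _ _ hu2 hv1 lc).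
  by rewrite /B ler_norml; apply/andP; split; lra.
have hC : `|C| <= 4.
  have [[? ?] [? ?]] := (M2 _ _ hw lc, M3 _ _ _ hu1 hv1 lc).
  by rewrite /C ler_norml; apply/andP; split; lra.
have e0 : 0 <= e by apply: le_trans ha.
rewrite (_ : 20 * e = e * 10 + e * 6 + e * 4); last by ring.
apply: le_trans (ler_normD _ _) _; rewrite lerD ?normrM ?ler_pM //.
by apply: le_trans (ler_normD _ _) _; rewrite lerD ?normrM ?ler_pM.
Qed.

(** Quantitative form of the gadget argument: up to errors,
x^2 y^2 = x^2 y^2 (p^2 + q^2) (r^2 + s^2), and each of the four terms of the
expansion contains one of the small products. [E2] and [E3] account for
replacing the two factors by 1, [E4], [E5], [E6] for the small terms
(21 + 21 + 23 + 23 + 23 = 111), and [E1] for passing from x^2 y^2 to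
x^2 (1 - x^2). *)
Lemma gadget_polynomial_bound (R : realFieldType) (x y p q r s e : R) :
  `|x| <= 1 -> `|y| <= 1 -> `|p| <= 1 -> `|q| <= 1 -> `|r| <= 1 -> `|s| <= 1 ->
  `|1 - (x ^+ 2 + y ^+ 2)| <= 21 * e -> `|1 - (p ^+ 2 + q ^+ 2)| <= 21 * e ->
  `|1 - (r ^+ 2 + s ^+ 2)| <= 21 * e ->
  `|q * y| <= 23 * e -> `|r * x| <= 23 * e -> `|s * p| <= 23 * e ->
  x ^+ 2 * (1 - x ^+ 2) <= 132 * e.
Proof.
move=> hx hy hp hq hr hs hxy hpq hrs qy rx sp.
have M1 (m t : R) : `|m| <= 1 -> `|t| <= 1 -> `|m * t| <= 1.
  exact: ler_norml_mul1.
have S (n m t : R) : `|m| <= n * e -> `|t| <= 1 -> m * t <= n * e.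
  move=> hm ht; apply: le_trans (ler_norm _) _.
  exact: ler_norml_mul1.
have E1 := S _ _ (x * x) hxy (M1 _ _ hx hx).
have E2 := S _ _ ((x * x) * (y * y)) hpq (M1 _ _ (M1 _ _ hx hx) (M1 _ _ hy hy)).
have E3 := S _ _ ((x * x) * (y * y) * (p * p)) hrs
  (M1 _ _ (M1 _ _ (M1 _ _ hx hx) (M1 _ _ hy hy)) (M1 _ _ hp hp)).
have E4 := S _ _ (x * x * (q * y)) qy (M1 _ _ (M1 _ _ hx hx) (M1 _ _ hq hy)).
have E5 := S _ _ ((y * y) * (p * p) * (r * x)) rx
   (M1 _ _ (M1 _ _ (M1 _ _ hy hy) (M1 _ _ hp hp)) (M1 _ _ hr hx)).
have E6 := S _ _ ((x * x) * (y * y) * (s * p)) sp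
  (M1 _ _ (M1 _ _ (M1 _ _ hx hx) (M1 _ _ hy hy)) (M1 _ _ hs hp)).
lra.
Qed.

(** * Almost orthogonal unit vectors in dimension three *)

(** The inner products of a family of unit vectors in a 3-dimensional Euclidean
space. Nonnegativity of the squared length of combinations of three vectors,
and vanishing of all 4 x 4 minors, express this as far as it is used. *)
Record unit_gram3 (R : realFieldType) (T : Type) (g : T -> T -> R) : Prop :=
UnitGram3 {
  gram_sym : forall x y, g x y = g y x;
  gram_diag : forall x, g x x = 1;
  gram_psd : forall x y z a b c,
    0 <= a ^+ 2 + b ^+ 2 + c ^+ 2
         + 2 * (a * b * g x y + a * c * g x z + b * c * g y z);
  gram_minor : forall f h : 'I_4 -> T,
    \det (\matrix_(i, j) g (f i) (h j)) = 0 }.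

Section Gram.
Variables (R : realFieldType) (T : Type) (g : T -> T -> R).
Hypothesis gG : unit_gram3 g.

Lemma gram_le1 x y : `|g x y| <= 1.
Proof.
have := gram_psd gG x y y 1 1 0; have := gram_psd gG x y y 1 (-1) 0.
by rewrite ler_norml; move=> *; apply/andP; split; lra.
Qed.

(** Expansion of the minor with rows [x, y, z, u] and columns [x, y, z, v]. *)
Lemma gram_bordered x y z u v :
  g u v * (1 - g x y ^+ 2 - g x z ^+ 2 - g y z ^+ 2
           + 2 * g x y * g x z * g y z) =
    g u x * g x v * (1 - g y z ^+ 2) + g u y * g y v * (1 - g x z ^+ 2)
  + g u z * g z v * (1 - g x y ^+ 2)
  + (g u x * g y v + g u y * g x v) * (g x z * g y z - g x y)
  + (g u x * g z v + g u z * g x v) * (g x y * g y z - g x z)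
  + (g u y * g z v + g u z * g y v) * (g x y * g x z - g y z).
Proof.
have := gram_minor gG (tnth [tuple x; y; z; u]) (tnth [tuple x; y; z; v]).
rewrite (expand_det_row _ ord0) !big_ord_recl big_ord0 /cofactor.
rewrite !(expand_det_row _ ord0) !big_ord_recl !big_ord0 /cofactor.
rewrite !(expand_det_row _ ord0) !big_ord_recl !big_ord0 /cofactor.
rewrite !det_mx11 !mxE.
rewrite !(tnth_nth x) /= /bump /= !(gram_diag gG).
rewrite (gram_sym gG y x) (gram_sym gG z x) (gram_sym gG z y).
move=> h; rewrite -[RHS]addr0 -h; ring.
Qed.

(** An almost orthonormal triple [x, y, z] is a basis, so inner products can be
computed, up to a small error, from the coordinates along it. *)
Lemma frame_expansion e x y z u v : e <= 1 ->
  `|g x y| <= e -> `|g x z| <= e -> `|g y z| <= e ->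
  `|g u v - (g u x * g x v + g u y * g y v + g u z * g z v)| <= 20 * e.
Proof.
move=> e1 xy xz yz.
by apply: (bordered_bound xy xz yz) (gram_bordered _ _ _ _ _) => //;
  apply: gram_le1.
Qed.

(** Expanding the fourth unit vector in the frame of the other three would give
it a squared length below 1. *)
Lemma no_four_near_orthogonal x y z u :
  `|g x y| <= 1 / 30 -> `|g x z| <= 1 / 30 -> `|g y z| <= 1 / 30 ->
  `|g x u| <= 1 / 30 -> `|g y u| <= 1 / 30 -> `|g z u| <= 1 / 30 -> False.
Proof.
move=> xy xz yz xu yu zu.
have e1 : 1 / 30 <= 1 :> R by lra.
have sq v : `|v| <= 1 / 30 -> v * v <= 1 / 30 :> R.
  move=> hv; apply: le_trans (ler_norm _) _; apply: ler_norml_mul1 => //.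
  exact: le_trans e1.
have /ler_norml_bounds[_] := frame_expansion u u e1 xy xz yz.
rewrite (gram_diag gG) !(gram_sym gG u).
by have := sq _ xu; have := sq _ yu; have := sq _ zu; lra.
Qed.

(** If [x] and [z] were orthogonal, Bessel's inequality would bound the sum [S]
of the squared correlations with the unit vector [y] by 1; the combination
used below has squared length S - S^2 up to the error due to [g x z]. *)
Lemma near_parallel_common e x y z : e <= 1 / 3 ->
  899 / 900 <= g x y ^+ 2 -> 899 / 900 <= g y z ^+ 2 -> `|g x z| <= e -> False.
Proof.
move=> e3 xy yz xz; set S := g x y ^+ 2 + g y z ^+ 2.
have hS : 3 / 2 <= S by rewrite /S; lra.
have := gram_psd gG x y z (g x y) (- S) (g y z).
have: S * (3 / 2) <= S * S by rewrite ler_pM2l //; lra.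
have /ler_norml_bounds[_] : `|g x z * (g x y * g y z)| <= e.
  apply: ler_norml_mul1 => //.
  by apply: ler_norml_mul1; apply: gram_le1.
rewrite (_ : g x y ^+ 2 + (- S) ^+ 2 + g y z ^+ 2 + _ =
  S - S * S + 2 * (g x z * (g x y * g y z))); last by rewrite /S; ring.
lra.
Qed.

(** The vertices of one gadget, with their nine edges, force the end points [i]
and [j] to be nearly orthogonal or nearly parallel. The threshold on [e] makes
t^2 (1 - t^2), with t the correlation of [i] and [j], smaller than its value at
t^2 = 1/900 and t^2 = 899/900. *)
Lemma gadget_dichotomy e i j a b c d : 132 * e < 899 / 900 * (1 / 900) ->
  `|g i a| <= e -> `|g i b| <= e -> `|g a b| <= e ->
  `|g j c| <= e -> `|g j d| <= e -> `|g c d| <= e ->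
  `|g a j| <= e -> `|g i d| <= e -> `|g b c| <= e ->
  (`|g i j| <= 1 / 30) || (899 / 900 <= g i j ^+ 2).
Proof.
move=> he ia ib ab jc jd cd aj di bc.
have e0 : 0 <= e by apply: le_trans ia.
have e1 : e <= 1 by lra.
have X u v := frame_expansion u v e1 ia ib ab.
have small s t : `|s| <= e -> `|t| <= 1 -> - e <= s * t /\ s * t <= e.
  by move=> hs ht; apply/ler_norml_bounds/ler_norml_mul1.
have L := gram_le1.
have norm_bound s t u : `|u| <= e -> `|1 - (s + u * u + t)| <= 20 * e ->
    `|1 - (s + t)| <= 21 * e :> R.
  move=> hu /ler_norml_bounds[h1 h2].
  have [h3 h4] := small _ _ hu (le_trans hu e1).
  by rewrite ler_norml; apply/andP; split; lra.
have dot_bound s t u w :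
    `|w| <= e -> - e <= s /\ s <= e -> - e <= t /\ t <= e ->
    `|w - (s + t + u)| <= 20 * e -> `|u| <= 23 * e :> R.
  move=> /ler_norml_bounds[? ?] [? ?] [? ?] /ler_norml_bounds[? ?].
  by rewrite ler_norml; apply/andP; split; lra.
have K := gadget_polynomial_bound (L i j) (L b j) (L a d) (L b d) (L i c)
  (L a c) (e := e).
have {K} : g i j ^+ 2 * (1 - g i j ^+ 2) <= 132 * e.
  apply: K.
  (* Unit length of j, d, c, then orthogonality of the pairs jd, jc, cd. *)
  - apply: (norm_bound _ _ _ aj); have := X j j.
    by rewrite (gram_diag gG) !(gram_sym gG j) !expr2.
  - apply: (norm_bound _ _ _ di); have := X d d.
    rewrite (gram_diag gG) !(gram_sym gG d) !expr2.
    by congr (`|_ - _| <= _); ring.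
  - apply: (norm_bound _ _ _ bc); have := X c c.
    rewrite (gram_diag gG) !(gram_sym gG c) !expr2.
    by congr (`|_ - _| <= _); ring.
  - apply: (dot_bound _ _ _ _ jd (small _ _ di (L i j)) (small _ _ aj (L a d))).
    have := X j d; rewrite !(gram_sym gG j).
    by congr (`|_ - _| <= _); ring.
  - apply: (dot_bound _ _ _ _ jc (small _ _ aj (L a c)) (small _ _ bc (L b j))).
    have := X j c; rewrite !(gram_sym gG j).
    by congr (`|_ - _| <= _); ring.
  - apply: (dot_bound _ _ _ _ cd (small _ _ di (L i c)) (small _ _ bc (L b d))).
    have := X c d; rewrite !(gram_sym gG c).
    by congr (`|_ - _| <= _); ring.
rewrite -(real_normK (num_real (g i j))); set t := `|g i j| => ht.
have t0 : 0 <= t by apply: normr_ge0.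
case: (leP t (1 / 30)) => //= t1; case: leP => // t2.
suff: 899 / 900 * (1 / 900) <= t ^+ 2 * (1 - t ^+ 2) by lra.
have t3 : 1 / 900 <= t ^+ 2.
  have: 1 / 30 * (1 / 30) <= t * t by apply: ler_pM; lra.
  by rewrite expr2; lra.
have: 0 <= (t ^+ 2 - 1 / 900) * (899 / 900 - t ^+ 2) by apply: mulr_ge0; lra.
lra.
Qed.

End Gram.

(** * Colouring from almost orthogonal unit vectors *)

(** Near parallelism is reflexive and symmetric, and its negation is near
orthogonality by the gadgets. By maximality, every vertex is nearly parallel to
some element of a maximal set [S] of pairwise non-parallel vertices; this
element, [rep x] below, is the colour of [x]. *)
Lemma near_orthogonal_colorable (R : realFieldType) (G : graph) (o : rel G)
    (g : peeters o -> peeters o -> R) (e : R) :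
  pair_listing o -> 132 * e < 899 / 900 * (1 / 900) -> unit_gram3 g ->
  (forall x y, peeters_adj x y -> `|g x y| <= e) -> colorable 3 G.
Proof.
move=> [_ oT] he gG ge.
have dich_o i j : o i j ->
    (`|g (inl i) (inl j)| <= 1 / 30) || (899 / 900 <= g (inl i) (inl j) ^+ 2).
  move=> oij; pose p : listed_pair o := exist _ (i, j) oij.
  have E (x y : peeters o) : (x, y) \in gadget_edges p -> `|g x y| <= e.
    by move=> xy; apply/ge/orP; right; apply/existsP; exists p; rewrite xy.
  by apply: (gadget_dichotomy gG (a := inr (p, Ga)) (b := inr (p, Gb))
    (c := inr (p, Gc)) (d := inr (p, Gd)) he); apply: E;
    rewrite !inE !eqxx ?orbT.
have dich i j : i != j -> ~~ (899 / 900 <= g (inl i) (inl j) ^+ 2) ->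
    `|g (inl i) (inl j)| <= 1 / 30.
  move=> ij npar; have := dich_o i j; have := dich_o j i.
  rewrite (gram_sym gG (inl j)) (oT i j ij) (negPf npar) orbF.
  by case: (o j i) => [/(_ isT)|_ /(_ isT)].
pose par i j := 899 / 900 <= g (inl i) (inl j) ^+ 2.
pose indep (S : {set G}) :=
  [forall x in S, forall y in S, (x != y) ==> ~~ par x y].
have [S /maxsetP[Sind Smax]] : {S | maxset indep S}.
  by apply: ex_maxset; exists set0; apply/forall_inP => x; rewrite inE.
have indepP x y : x \in S -> y \in S -> x != y -> ~~ par x y.
  by move=> xS yS; move/forall_inP/(_ x xS)/forall_inP/(_ y yS)/implyP: Sind.
have parC x y : par x y = par y x by rewrite /par (gram_sym gG).
have parxx x : par x x by rewrite /par (gram_diag gG); lra.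
have cover x : exists z, (z \in S) && par x z.
  apply/existsP; case: (boolP [exists z in S, par x z]) => //.
  rewrite negb_exists_in => /forall_inP nx.
  have xS : x \in S.
    rewrite -[S](Smax (x |: S)) ?setU11 ?subsetUr //.
    apply/forall_inP => y; rewrite !inE => hy.
    apply/forall_inP => z; rewrite !inE => hz; apply/implyP => yz.
    case/predU1P: hy => [y_x|yS]; case/predU1P: hz => [z_x|zS].
    - by rewrite y_x z_x eqxx in yz.
    - by rewrite y_x nx.
    - by rewrite z_x parC nx.
    - exact: indepP.
  by have := nx x xS; rewrite parxx.
have S3 : (#|S| <= 3)%N.
  rewrite leqNgt; apply/negP => S4.
  pose z (k : 'I_4) := enum_val (widen_ord S4 k).
  have zz (k l : 'I_4) : k != l -> `|g (inl (z k)) (inl (z l))| <= 1 / 30.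
    move=> kl; have zkl : z k != z l by rewrite (inj_eq enum_val_inj).
    by apply: dich => //; apply: indepP => //; apply: enum_valP.
  pose k0 : 'I_4 := Ordinal (isT : (0 < 4)%N).
  pose k1 : 'I_4 := Ordinal (isT : (1 < 4)%N).
  pose k2 : 'I_4 := Ordinal (isT : (2 < 4)%N).
  pose k3 : 'I_4 := Ordinal (isT : (3 < 4)%N).
  exact: (no_four_near_orthogonal gG (zz k0 k1 isT) (zz k0 k2 isT)
    (zz k1 k2 isT) (zz k0 k3 isT) (zz k1 k3 isT) (zz k2 k3 isT)).
pose rep x := xchoose (cover x).
have repP x : rep x \in S /\ par x (rep x) by have /andP := xchooseP (cover x).
exists (fun x => widen_ord S3 (enum_rank_in (repP x).1 (rep x))) => x y xy.
apply/eqP => /(congr1 (@nat_of_ord 3)) /= fxy.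
have rxy : rep x = rep y.
  rewrite -(enum_rankK_in (repP x).1 (repP x).1).
  rewrite -(enum_rankK_in (repP y).1 (repP y).1).
  by congr enum_val; apply: val_inj.
have [_ px] := repP x; have [_ py] := repP y.
rewrite -rxy parC in py.
apply: (near_parallel_common gG _ px py (e := e)); first by lra.
by apply: ge; rewrite /peeters_adj xy.
Qed.

(** * Unit vectors from a low-rank positive semidefinite matrix *)

Lemma symmetricmx_sym (R : realType) N (M : 'M[R]_N) u v :
  M \is symmetricmx -> M u v = M v u.
Proof.
move=> /is_hermitianmxP; rewrite expr0 scale1r map_mx_id // => {1}->.
by rewrite mxE.
Qed.

Lemma psd_quadratic3 (R : realType) N (M : 'M[R]_N) (u v w : 'I_N) (a b c : R) :
  M \is symmetricmx -> psd M ->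
  0 <= a ^+ 2 * M u u + b ^+ 2 * M v v + c ^+ 2 * M w w
       + 2 * (a * b * M u v + a * c * M u w + b * c * M v w).
Proof.
move=> Msym /(_ (a *: delta_mx u 0 + b *: delta_mx v 0 + c *: delta_mx w 0)).
have E x y : \sum_k ((delta_mx x 0 : 'cV[R]_N)^T *m M) 0 k
                 * (delta_mx y 0 : 'cV[R]_N) k 0 = M x y.
  transitivity (((delta_mx x 0 : 'cV_N)^T *m M *m delta_mx y (0 : 'I_1)) 0 0).
    by rewrite [RHS]mxE.
  by rewrite trmx_delta -rowE -colE !mxE.
rewrite !linearD !linearZ /= !mulmxDl -!scalemxAl !mxE !E.
rewrite (symmetricmx_sym v u Msym) (symmetricmx_sym w u Msym).
rewrite (symmetricmx_sym w v Msym) => h; apply: le_trans h _; lra.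
Qed.

(** A scaled submatrix larger than the rank is singular; the weights [a], [b]
will be inverse lengths. *)
Lemma minor_rank0 (R : fieldType) m N r (M : 'M[R]_N) (s t : 'I_m -> 'I_N)
    (a b : 'I_m -> R) :
  (\rank M <= r)%N -> (r < m)%N ->
  \det (\matrix_(i, j) (a i * M (s i) (t j) * b j)) = 0.
Proof.
move=> Mr rm; apply/eqP; apply: contraTT rm => d0; rewrite -leqNgt.
set D := (X in \det X) in d0.
have Du : D \in unitmx by rewrite unitmxE unitfE.
rewrite -(mxrank_unit Du); apply: leq_trans Mr.
have -> : D = diag_mx (\row_i a i) *m
    (rowsub s 1%:M *m (M *m colsub t 1%:M)) *m diag_mx (\row_j b j).
  apply/matrixP => i j.
  rewrite mul_mx_diag mulmx_colsub mulmx1 mul_rowsub_mx mul1mx mul_diag_mx.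
  by rewrite !mxE.
rewrite -mulmxA; apply: leq_trans (mxrankM_maxr _ _) _.
apply: leq_trans (mxrankM_maxl _ _) _; apply: leq_trans (mxrankM_maxr _ _) _.
exact: mxrankM_maxl.
Qed.

Lemma normalized_gram (R : realType) (T : Type) N (M : 'M[R]_N)
    (s : T -> 'I_N) :
  M \is symmetricmx -> psd M -> (\rank M <= 3)%N ->
  (forall x, 0 < M (s x) (s x)) ->
  unit_gram3 (fun x y => (Num.sqrt (M (s x) (s x)))^-1 * M (s x) (s y)
                         * (Num.sqrt (M (s y) (s y)))^-1).
Proof.
move=> Msym Mpsd Mr Mpos.
have diag1 x : (Num.sqrt (M (s x) (s x)))^-1 ^+ 2 * M (s x) (s x) = 1.
  by rewrite exprVn sqr_sqrtr ?ltW // mulVf // gt_eqF.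
split=> [x y|x|x y z a b c|f h].
- by rewrite (symmetricmx_sym _ _ Msym); ring.
- by rewrite -[RHS](diag1 x); ring.
- have := psd_quadratic3 (s x) (s y) (s z) (a / Num.sqrt (M (s x) (s x)))
    (b / Num.sqrt (M (s y) (s y))) (c / Num.sqrt (M (s z) (s z))) Msym Mpsd.
  have sc t (r : R) :
      (r / Num.sqrt (M (s t) (s t))) ^+ 2 * M (s t) (s t) = r ^+ 2.
    by rewrite exprMn -mulrA diag1 mulr1.
  rewrite !sc.
  by move=> H; apply: le_trans H _; rewrite !lerD //; lra.
- exact: (@minor_rank0 _ _ _ _ M (s \o f) (s \o h)
    (fun i => (Num.sqrt (M (s (f i)) (s (f i))))^-1)
    (fun j => (Num.sqrt (M (s (h j)) (s (h j))))^-1) Mr).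
Qed.

Lemma frobenius_entry (R : realType) N (H : 'M[R]_N) u v :
  `|H u v| <= frobenius_norm H.
Proof.
rewrite -sqrtr_sqr; apply: ler_wsqrtr.
rewrite (bigD1 u) //= (bigD1 v) //= -addrA lerDl.
rewrite addr_ge0 // ?sumr_ge0 // => i _.
  by rewrite sqr_ge0.
by apply: sumr_ge0 => j _; rewrite sqr_ge0.
Qed.

(** * Extending a colouring over the gadgets *)

(** A colouring of the four new vertices compatible with the colours [ci], [cj]
of the end points; [- (ci + cj)] is the colour different from both when they
differ, as the three elements of Z/3 sum to 0. *)
Definition gadget_color (ci cj : 'I_3) (t : gadget) : 'I_3 :=
  if ci == cj then match t with Ga | Gc => ci + 1 | Gb | Gd => ci - 1 end
  else match t with Ga | Gd => - (ci + cj) | Gb => cj | Gc => ci end.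

Lemma gadget_color_proper (ci cj : 'I_3) :
  let k := gadget_color ci cj in
  [/\ ci != k Ga, ci != k Gb & k Ga != k Gb] /\
  [/\ cj != k Gc, cj != k Gd & k Gc != k Gd] /\
  [/\ k Ga != cj, ci != k Gd & k Gb != k Gc].
Proof.
by case: ci => [[|[|[|//]]] ?]; case: cj => [[|[|[|//]]] ?].
Qed.

Lemma peeters_colorable (G : graph) (o : rel G) :
  colorable 3 G -> colorable 3 (peeters o).
Proof.
move=> [f fP].
pose F (x : peeters o) : 'I_3 := match x with
  | inl i => f i
  | inr (p, t) => gadget_color (f (val p).1) (f (val p).2) t end.
exists F => x y /orP[|/existsP[p]].
  by case: x y => [i|u] [j|v] //; apply: fP.
have [[h1 h2 h3] [[h4 h5 h6] [h7 h8 h9]]] :=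
  gadget_color_proper (f (val p).1) (f (val p).2).
have E x' y' : (x', y') \in gadget_edges p -> F x' != F y'.
  by rewrite !inE => /or4P[|||/or4P[|||/or3P[]]]; case/eqP=> -> ->.
by case/orP => /E //; rewrite eq_sym.
Qed.

Lemma eq_set2P (T : finType) (a b c d : T) :
  [set a; b] = [set c; d] -> (a = c /\ b = d) \/ (a = d /\ b = c).
Proof.
move=> E.
have := set21 a b; have := set22 a b; have := set21 c d; have := set22 c d.
rewrite {1 2}E -{1 2}E !inE.
by do 4 case/orP => /eqP ?; subst; auto.
Qed.

(** * The input construction *)

Section P3.
Variable G : graph.

Lemma P3_pairs_adj (x y : G) mu nu :
  adj x y -> [set copy_index x mu; copy_index y nu] \in P3_pairs G.
Proof.
move=> xy; rewrite inE; apply/orP; left; apply/bigcupP; exists (x, y) => //.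
by apply/imset2P; exists mu nu.
Qed.

Lemma P3_pairs_copies (x : G) mu nu :
  mu != nu -> [set copy_index x mu; copy_index x nu] \in P3_pairs G.
Proof.
move=> mn; rewrite inE; apply/orP; right; apply/bigcupP; exists x => //.
by apply/imsetP; exists (mu, nu); rewrite ?inE.
Qed.

Lemma P3_pairsP (u v : 'I_(#|G| * 3)) : [set u; v] \in P3_pairs G ->
  exists x y mu nu, [/\ u = copy_index x mu, v = copy_index y nu &
                        adj x y \/ x = y /\ mu != nu].
Proof.
rewrite inE => /orP[] /bigcupP.
  move=> [[x y] /= xy] /imset2P[mu nu _ _] /eq_set2P[] [-> ->].
    by exists x, y, mu, nu; split=> //; left.
  by exists y, x, nu, mu; split=> //; left; rewrite adj_sym.
move=> [x _] /imsetP[[mu nu]]; rewrite inE /= => mn /eq_set2P[] [-> ->].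
  by exists x, x, mu, nu; split=> //; right.
by exists x, x, nu, mu; split=> //; right; rewrite eq_sym.
Qed.

Lemma trmx_P3_matrix (R : realType) : (P3_matrix G R)^T = P3_matrix G R.
Proof. by rewrite linearB /= trmx_tens !trmx1 trmx_const. Qed.

Lemma P3_completion (R : realType) : colorable 3 G ->
  exists L : 'M[R]_(#|G| * 3),
    [/\ L \is symmetricmx, fits L (P3_pairs G),
        (\rank (P3_matrix G R + L)%R <= 3)%N & psd (P3_matrix G R + L)].
Proof.
move=> [f fP]; set A := P3_matrix G R.
(* Row (x, mu) of B is the basis vector indexed by the colour of x. *)
pose B : 'M[R]_(#|G| * 3, 3) :=
  \matrix_(u, k) (f (enum_val (mxtens_unindex u).1) == k)%:R.
have BE x mu k : B (copy_index x mu) k = (f x == k)%:R.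
  by rewrite mxE mxtens_indexK enum_rankK.
have ME x y mu nu :
    (B *m B^T) (copy_index x mu) (copy_index y nu) = (f x == f y)%:R.
  transitivity (\sum_k (f x == k)%:R * (f y == k)%:R : R).
    by rewrite mxE; apply: eq_bigr => k _; rewrite [_^T _ _]mxE !BE.
  rewrite (bigD1 (f x)) //= eqxx mul1r big1 ?addr0 => [|k].
    by rewrite eq_sym.
  by rewrite eq_sym => /negPf->; rewrite mul0r.
have AL : A + (B *m B^T - A) = B *m B^T by rewrite addrC subrK.
exists (B *m B^T - A); rewrite AL; split.
- apply/is_hermitianmxP; rewrite expr0 scale1r map_mx_id // [RHS]linearB /=.
  by rewrite trmx_mul trmxK trmx_P3_matrix.
- move=> u v /P3_pairsP[x [y [mu [nu [-> -> h]]]]].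
  rewrite [LHS]mxE ME [X in _ + X]mxE P3_matrixE.
  case: h => [xy|[-> ->]]; last by rewrite !eqxx subrr.
  rewrite (negPf (fP _ _ xy)); case: eqP => [E|_]; last by rewrite subrr.
  by rewrite E adj_irr in xy.
- exact: mulmx_max_rank.
- move=> x; rewrite mulmxA -mulmxA -[x^T *m B]trmxK trmx_mul trmxK mxE.
  by apply: sumr_ge0 => k _; rewrite mxE -expr2 sqr_ge0.
Qed.

(** Two copies p, q of one vertex have inner product at least 1 - eps, so
|p|^2 + |q|^2 >= 2 <p, q> makes one of them have squared length at least 1/2:
this replaces control of the unconstrained diagonal. Dividing an inner product
of size at most [eps] by two lengths whose product is at least 1/2 costs the
factor 2. *)
Lemma P3_correlations (R : realType) (eps : R) (L H : 'M[R]_(#|G| * 3)) :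
  let M := P3_matrix G R + L + H in
  eps <= 1 / 2 -> L \is symmetricmx -> H \is symmetricmx ->
  fits L (P3_pairs G) ->
  frobenius_norm H <= eps -> psd M -> (\rank M <= 3)%N ->
  exists2 g : G -> G -> R, unit_gram3 g &
    forall x y, adj x y -> `|g x y| <= 2 * eps.
Proof.
move=> M e2 Lsym Hsym LX He Mpsd Mr.
have Hb u v : `|H u v| <= eps by apply: le_trans He; apply: frobenius_entry.
have ME u v : M u v = P3_matrix G R u v + L u v + H u v.
  by rewrite mxE [X in X + _]mxE.
clearbody M.
have Msym : M \is symmetricmx.
  apply/is_hermitianmxP; rewrite expr0 scale1r map_mx_id //.
  apply/matrixP => u v; rewrite [RHS]mxE !ME.
  rewrite (symmetricmx_sym u v Lsym) (symmetricmx_sym u v Hsym).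
  by rewrite -[in LHS]trmx_P3_matrix [in LHS]mxE.
have Madj x y mu nu : adj x y ->
    `|M (copy_index x mu) (copy_index y nu)| <= eps.
  move=> xy; rewrite ME (LX _ _ (P3_pairs_adj _ _ xy)) P3_matrixE.
  by case: eqP => [E|_]; [rewrite E adj_irr in xy | rewrite !add0r].
pose k0 : 'I_3 := ord0; pose k1 : 'I_3 := lift ord0 ord0.
pose s x := if 1 / 2 <= M (copy_index x k0) (copy_index x k0)
            then copy_index x k0 else copy_index x k1.
have sE x : exists mu, s x = copy_index x mu.
  by rewrite /s; case: ifP; eexists.
have s2 x : 1 / 2 <= M (s x) (s x).
  rewrite /s; case: ifPn => //; rewrite -ltNge => h0.
  have k01 : k0 != k1 by [].
  have := psd_quadratic3 (copy_index x k0) (copy_index x k1) (copy_index x k1)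
    1 (-1) 0 Msym Mpsd.
  have : M (copy_index x k0) (copy_index x k1)
         = 1 + H (copy_index x k0) (copy_index x k1).
    by rewrite ME (LX _ _ (P3_pairs_copies _ k01)) P3_matrixE eqxx k01 addr0.
  have /ler_norml_bounds[h1 _] := Hb (copy_index x k0) (copy_index x k1).
  lra.
have s0 x : 0 < M (s x) (s x) by apply: lt_le_trans (s2 x); lra.
exists (fun x y => (Num.sqrt (M (s x) (s x)))^-1 * M (s x) (s y)
                    * (Num.sqrt (M (s y) (s y)))^-1).
  exact: normalized_gram.
move=> x y xy.
have n0 z : 0 < Num.sqrt (M (s z) (s z)) by rewrite sqrtr_gt0.
rewrite mulrAC normrM ger0_norm ?mulr_ge0 ?invr_ge0 ?sqrtr_ge0 //.
have hM : `|M (s x) (s y)| <= eps.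
  by have [mu ->] := sE x; have [nu ->] := sE y; apply: Madj.
rewrite mulrC (mulrC _ eps); apply: ler_pM => //.
  by rewrite mulr_ge0 // invr_ge0 sqrtr_ge0.
rewrite -invfM invf_ple ?posrE ?mulr_gt0 //.
rewrite -(ler_pXn2r (n := 2)) ?nnegrE ?mulr_ge0 ?sqrtr_ge0 //; last by lra.
rewrite exprMn !sqr_sqrtr ?(ltW (s0 _)) // expr2.
by apply: ler_pM; rewrite ?invr_ge0 // -[_^-1]mul1r.
Qed.

End P3.

Theorem theorem3p4 (R : realType) :
  exists eps0 : R, 0 < eps0 /\
  forall (G : graph) (o : rel G), pair_listing o ->
    let G' := peeters o in
    let A := P3_matrix G' R in
    let X := P3_pairs G' in
    (colorable 3 G ->
       exists L : 'M[R]_(#|G'| * 3),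
         [/\ L \is symmetricmx, fits L X, (\rank (A + L)%R <= 3)%N & psd (A + L)])
    /\
    ((exists L H : 'M[R]_(#|G'| * 3),
        [/\ L \is symmetricmx, H \is symmetricmx &
         [/\ fits L X, frobenius_norm H <= eps0, psd (A + L + H)
           & (\rank (A + L + H)%R <= 3)%N]]) ->
     colorable 3 G).
Proof.
(* Correlations of adjacent vertices are then at most 2 / 10^6, and
   132 * 2 / 10^6 < 899 / 900^2, the threshold of the gadget argument. *)
exists (1 / 1000 * (1 / 1000)); split; first by lra.
move=> G o oP G' A X; split; first by move/(peeters_colorable o)/P3_completion.
case=> L [H [Lsym Hsym [LX Hsmall Mpsd Mrank]]].
have small : 1 / 1000 * (1 / 1000) <= 1 / 2 :> R by lra.
have [g gG gadj] := P3_correlations small Lsym Hsym LX Hsmall Mpsd Mrank.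
by apply: near_orthogonal_colorable oP _ gG gadj; lra.
Qed.
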